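(* For every even integer $k\ge 4$ and every integer $\ell\ge 2$ there is a constant $C=C(k,\ell)$ such that for all sufficiently large $n$, $$\mathrm{ex}(n,T_{k,\ell})\le C\, n^{\frac32+\frac{\ell}{k}}(\log n)^2.$$
   Context: $\mathrm{ex}(n,F)$ is the maximum number of edges in an $n$-vertex graph with no subgraph isomorphic to $F$; $\log$ is base 2. For even $k\ge 4$ and $\ell\ge 2$, the quadrangulated torus $T_{k,\ell}$ has vertex set $\{x_{i,j}:1\le i\le k,\ 1\le j\le \ell\}$ (all distinct) and edge set $\{x_{i,j}x_{i+1,j}:1\le i\le k,\ 1\le j\le\ell\}\cup\{x_{i,j+1}x_{i+1,j}:1\le i\le k,\ 1\le j\le \ell,\ i\text{ odd}\}\cup\{x_{i,j}x_{i+1,j+1}:1\le i\le k,\ 1\le j\le\ell,\ i\text{ even}\}$, where both coordinates are cyclic: $x_{k+1,j}=x_{1,j}$ for all $j$ and $x_{i,\ell+1}=x_{i,1}$ for all $i$. *)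

(* Defs.v *)
From mathcomp Require Import all_boot all_order.
Set Implicit Arguments. Unset Strict Implicit. Unset Printing Implicit Defensive.

Definition simple_graph (n : nat) (E : {set {set 'I_n}}) : bool :=
  [forall e in E, #|e| == 2].

Definition contains_copy (V : finType) (F : rel V) (n : nat)
    (E : {set {set 'I_n}}) : bool :=
  [exists f : {ffun V -> 'I_n}, injectiveb f &&
    [forall u, forall v, F u v ==> ([set f u; f v] \in E)]].

Definition ex (V : finType) (F : rel V) (n : nat) : nat :=
  \max_(E : {set {set 'I_n}} | simple_graph E &&
                                ~~ contains_copy F E) #|E|.

(* Quadrangulated torus T_{k,l}, vertices x_{i,j} indexed 0-based:
   vertex (i,j) : 'I_k * 'I_l stands for x_{i+1,j+1}.
   Edges between column i and column i+1 (mod k): (i,a)-(i+1,b) when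
   b = a; additionally, when the paper index i+1 is odd (i even),
   x_{i,j+1}x_{i+1,j} gives a = b+1 (mod l); when i+1 is even (i odd),
   x_{i,j}x_{i+1,j+1} gives b = a+1 (mod l). *)
Definition torus_step (k l : nat) (x y : 'I_k * 'I_l) : bool :=
  let: (i, a) := x in let: (i', b) := y in
  ((i' : nat) == (i.+1 %% k)) &&
  [|| (b : nat) == a,
      (~~ odd i) && ((a : nat) == (b.+1 %% l)) |
      odd i && ((b : nat) == (a.+1 %% l))].

Definition torus_adj (k l : nat) : rel ('I_k * 'I_l) :=
  fun x y => torus_step x y || torus_step y x.

(* Main.v *)
Require Import Defs.
From mathcomp Require Import all_boot all_order all_algebra.
From mathcomp Require Import ring lra zify.

(* Let G have n vertices and minimum degree d, and consider the graph on l-tuples of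
   vertices in which x and y are adjacent when x_0 y_0 x_1 y_1 ... is a 2l-cycle of G.
   A copy of the torus is a closed walk of length k = 2m in this graph whose tuples
   are pairwise disjoint.

   Weight every 2l-cycle by its probability under the random walk on G.  The closed
   walks have total weight at least 1, whereas cycles constrained by prescribing one
   vertex of one side as a function of the rest have weight at most n / d^2.  Deleting
   tuples greedily leaves a nonempty weighted graph of tuples in which a random
   neighbour of a tuple hits a given vertex with probability O(n / d^2).

   For the reversible random walk P on this graph, on N <= 2 n^l states, closed walks
   of length 2m in which two tuples meet are bounded, following Janzer, by
   s c tr P^2m + c^-1 tr P^(2m-2) for every c > 0, where s = O(n / d^2).
   Log-convexity gives tr P^(2m-2) <= N^(1/m) tr P^2m, so a good closed walk
   exists as soon as s N^(1/m) is small, that is, d >= C n^(1/2 + l/k). *)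

Set Implicit Arguments. Unset Strict Implicit. Unset Printing Implicit Defensive.
Import Order.TTheory GRing.Theory Num.Theory.
Local Open Scope ring_scope.

(** * Cyclic sums of products of kernels *)

Section Kernels.
Variables (F : realFieldType) (T : finType).
Implicit Types (K : nat -> T -> T -> F) (n : nat).

Fixpoint kprod K n (u v : T) : F :=
  if n is n'.+1 then \sum_w kprod K n' u w * K n' w v else (u == v)%:R.

Definition frcons n (x : {ffun 'I_n -> T}) (v : T) : {ffun 'I_n.+1 -> T} :=
  [ffun i => if unlift ord_max i is Some j then x j else v].

Lemma frcons_widen n (x : {ffun 'I_n -> T}) v (i : 'I_n) :
  frcons x v (widen_ord (leqnSn n) i) = x i.
Proof.
have -> : widen_ord (leqnSn n) i = lift ord_max i by apply: val_inj; rewrite /= /bump leqNgt ltn_ord.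
by rewrite ffunE liftK.
Qed.

Lemma frcons_max n (x : {ffun 'I_n -> T}) v : frcons x v ord_max = v.
Proof. by rewrite ffunE unlift_none. Qed.

Lemma sum_ffun_rcons n (f : {ffun 'I_n.+1 -> T} -> F) :
  \sum_x f x = \sum_(x : {ffun 'I_n -> T}) \sum_v f (frcons x v).
Proof.
rewrite pair_big /= (reindex (fun p : {ffun 'I_n -> T} * T => frcons p.1 p.2)) //=.
exists (fun x => ([ffun i => x (widen_ord (leqnSn n) i)], x ord_max)) => [[x v] _|x _] /=.
  congr (_, _); last exact: frcons_max.
  by apply/ffunP => i; rewrite ffunE frcons_widen.
apply/ffunP => i; rewrite ffunE; case: unliftP => [j ->|-> //].
by rewrite ffunE; congr (x _); apply: val_inj; rewrite /= /bump leqNgt ltn_ord.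
Qed.

Lemma sum_path K n (g : T -> T -> F) :
  \sum_(x : {ffun 'I_n.+1 -> T})
     (\prod_(i < n) K i (x (widen_ord (leqnSn n) i)) (x (lift ord0 i)))
     * g (x ord0) (x ord_max)
  = \sum_u \sum_v kprod K n u v * g u v.
Proof.
elim: n g => [|n IH] g.
  rewrite sum_ffun_rcons (big_pred1 [ffun i : 'I_0 => False_rect T (notF (ltn_ord i))]).
    apply: eq_bigr => u _; rewrite big_ord0 mul1r.
    have -> : ord0 = ord_max :> 'I_1 by apply: val_inj.
    rewrite frcons_max (bigD1 u) //= eqxx mul1r big1 ?addr0 // => v.
    by rewrite eq_sym => /negbTE ->; rewrite mul0r.
  by move=> x /=; symmetry; apply/eqP/ffunP => -[].
rewrite sum_ffun_rcons.
transitivity (\sum_(x : {ffun 'I_n.+1 -> T})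
     (\prod_(i < n) K i (x (widen_ord (leqnSn n) i)) (x (lift ord0 i)))
     * (\sum_v K n (x ord_max) v * g (x ord0) v)).
  apply: eq_bigr => x _; rewrite mulr_sumr; apply: eq_bigr => v _.
  rewrite big_ord_recr /= frcons_widen.
  have -> : lift ord0 (@ord_max n) = ord_max by apply: val_inj.
  have E0 : ord0 = widen_ord (leqnSn n.+1) (@ord0 n) by apply: val_inj.
  rewrite {2}E0 frcons_widen frcons_max mulrA; congr (_ * _ * _).
  apply: eq_bigr => i _.
  have E1 : lift ord0 (widen_ord (leqnSn n) i) = widen_ord (leqnSn n.+1) (lift ord0 i).
    by apply: val_inj.
  by rewrite E1 !frcons_widen.
rewrite (IH (fun a b => \sum_v K n b v * g a v)).
apply: eq_bigr => u _.
under eq_bigr do rewrite mulr_sumr.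
rewrite exchange_big /=; apply: eq_bigr => v _.
by rewrite mulr_suml; apply: eq_bigr => w _; rewrite mulrA.
Qed.

Lemma sum_cycle (K : T -> nat -> T -> T -> F) n :
  \sum_(x : {ffun 'I_n.+1 -> T}) \prod_(i < n.+1) K (x ord0) i (x i) (x (ordS i))
  = \sum_u kprod (K u) n.+1 u u.
Proof.
transitivity (\sum_u \sum_(x : {ffun 'I_n.+1 -> T})
    (\prod_(i < n) K u i (x (widen_ord (leqnSn n) i)) (x (lift ord0 i)))
     * ((x ord0 == u)%:R * K u n (x ord_max) u)).
  rewrite exchange_big /=; apply: eq_bigr => x _.
  rewrite (bigD1 (x ord0)) //= [X in _ + X]big1 ?addr0; last first.
    by move=> u; rewrite eq_sym => /negbTE ->; rewrite mul0r mulr0.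
  rewrite eqxx mul1r big_ord_recr /=.
  have -> : ordS (@ord_max n) = ord0 by apply: val_inj; rewrite /= modnn.
  congr (_ * _); apply: eq_bigr => i _; congr (K _ _ _ (x _)).
  by apply: val_inj; rewrite /= modn_small // ltnS.
apply: eq_bigr => u _.
rewrite (sum_path (K u) n (fun a b => (a == u)%:R * K u n b u)).
rewrite (bigD1 u) //= [X in _ + X]big1 ?addr0; last first.
  by move=> a /negbTE ->; rewrite big1 // => v _; rewrite mul0r mulr0.
by apply: eq_bigr => v _; rewrite eqxx mul1r.
Qed.

End Kernels.

Section KernelProducts.
Variables (F : realFieldType) (T : finType).
Implicit Types (K : nat -> T -> T -> F) (n : nat).

Lemma sum_delta (u : T) (f : T -> F) : \sum_w (u == w)%:R * f w = f u.
Proof.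
rewrite (bigD1 u) //= eqxx mul1r big1 ?addr0 // => w.
by rewrite eq_sym => /negbTE ->; rewrite mul0r.
Qed.

Lemma kprod1 K u v : kprod K 1 u v = K 0%N u v.
Proof. exact: sum_delta. Qed.

Lemma eq_kprod K L n u v :
  (forall i, (i < n)%N -> K i =2 L i) -> kprod K n u v = kprod L n u v.
Proof.
elim: n v => [//|n IH] v KL /=; apply: eq_bigr => w _.
by rewrite KL // IH // => i /ltnW /KL.
Qed.

Lemma kprod_ge0 K n u v : (forall i a b, 0 <= K i a b) -> 0 <= kprod K n u v.
Proof.
move=> K0; elim: n v => [|n IH] v /=; first exact: ler0n.
by apply: sumr_ge0 => w _; rewrite mulr_ge0.
Qed.

Lemma kprodD K i j u v :
  kprod K (i + j) u v = \sum_w kprod K i u w * kprod (fun t => K (i + t)%N) j w v.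
Proof.
elim: j v => [|j IH] v /=.
  rewrite addn0 -(sum_delta v (fun w => kprod K i u w)).
  by apply: eq_bigr => w _; rewrite mulrC eq_sym.
rewrite addnS /=; under eq_bigr do rewrite IH mulr_suml.
rewrite exchange_big /=; apply: eq_bigr => w _.
by rewrite mulr_sumr; apply: eq_bigr => t _; rewrite mulrA.
Qed.

End KernelProducts.

(** * Reversible Markov chains *)

Section ReversibleChain.
Variables (F : realFieldType) (T : finType) (mu : T -> T -> F).
Hypothesis mu_ge0 : forall u v, 0 <= mu u v.
Hypothesis mu_sym : forall u v, mu u v = mu v u.

Definition mass u := \sum_v mu u v.
Definition trans u v := mu u v / mass u.

Hypothesis mass_gt0 : forall u, 0 < mass u.

Definition ptrans := locked (fun n => kprod (fun=> trans) n).
Definition ptrace n := \sum_u ptrans n u u.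

Local Notation p := ptrans.
Local Notation P := trans.
Local Notation t := ptrace.

Let mass_neq0 u : mass u != 0. Proof. by rewrite gt_eqF. Qed.

Lemma trans_ge0 u v : 0 <= P u v.
Proof. by rewrite /trans divr_ge0 // ltW. Qed.

Lemma ptransE n : p n = kprod (fun=> P) n.
Proof. by rewrite /ptrans -lock. Qed.

Lemma ptrans0 u v : p 0 u v = (u == v)%:R.
Proof. by rewrite ptransE. Qed.

Lemma ptransS n u v : p n.+1 u v = \sum_w p n u w * P w v.
Proof. by rewrite !ptransE. Qed.

Lemma ptransD i j u v : p (i + j) u v = \sum_w p i u w * p j w v.
Proof. by rewrite !ptransE kprodD. Qed.

Lemma ptrans1 u v : p 1 u v = P u v.
Proof. by rewrite ptransE kprod1. Qed.

Lemma ptrans_ge0 n u v : 0 <= p n u v.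
Proof. by rewrite ptransE; apply: kprod_ge0 => _; apply: trans_ge0. Qed.

Lemma trans_sum u : \sum_v P u v = 1.
Proof. by rewrite -mulr_suml -/(mass u) mulfV ?mass_neq0. Qed.

Lemma ptrans_sum n u : \sum_v p n u v = 1.
Proof.
elim: n => [|n IH].
  rewrite -(sum_delta u (fun=> 1)); apply: eq_bigr => v _.
  by rewrite ptrans0 mulr1.
under eq_bigr do rewrite ptransS.
rewrite exchange_big /= -[RHS]IH; apply: eq_bigr => w _.
by rewrite -mulr_sumr trans_sum mulr1.
Qed.

Lemma trans_rev u v : mass u * P u v = mass v * P v u.
Proof. by rewrite /trans !(mulrC (mass _)) !divfK // mu_sym. Qed.

Lemma ptrans_rev n u v : mass u * p n u v = mass v * p n v u.
Proof.
elim: n u v => [|n IH] u v.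
  by rewrite !ptrans0 (eq_sym u); case: eqP => [->//|_]; rewrite !mulr0.
rewrite ptransS (ptransD 1 n v) !mulr_sumr; apply: eq_bigr => w _.
by rewrite ptrans1 [RHS]mulrA (trans_rev v w) [LHS]mulrA IH mulrAC.
Qed.

Lemma ptrans_flip n u v : p n v u = mass u / mass v * p n u v.
Proof.
by apply: (mulfI (mass_neq0 v)); rewrite -ptrans_rev mulrA mulrCA mulfV // mulr1.
Qed.

Lemma ptraceD i j : t (i + j) = \sum_u \sum_v p i u v * p j v u.
Proof. by apply: eq_bigr => u _; rewrite ptransD. Qed.

Lemma ptrace0 : t 0 = #|T|%:R.
Proof.
rewrite /ptrace (eq_bigr (fun=> 1)); first by rewrite sumr_const cardT -cardE.
by move=> u _; rewrite ptrans0 eqxx.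
Qed.

(* For fixed (u, v) the quantity [p i u v * p j v u] is the product of
   [sqrt (m u / m v) * p i u v] and the same expression in [j]. *)
Lemma ptrans_amgm i j c u v :
  2%:R * c * (p i u v * p j v u) <= c ^+ 2 * (p i u v * p i v u) + p j u v * p j v u.
Proof.
rewrite !(ptrans_flip _ u v); set q := mass u / mass v.
have q0 : 0 <= q by rewrite divr_ge0 // ltW.
rewrite -subr_ge0; have -> : c ^+ 2 * (p i u v * (q * p i u v)) + p j u v * (q * p j u v)
  - 2%:R * c * (p i u v * (q * p j u v)) = q * (c * p i u v - p j u v) ^+ 2 by ring.
by rewrite mulr_ge0 // sqr_ge0.
Qed.

Lemma ptrace_ge0 n : 0 <= t n.
Proof. by apply: sumr_ge0 => u _; apply: ptrans_ge0. Qed.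

Lemma ptrace_even_ge1 n (u0 : T) : 1 <= t (n + n).
Proof.
have M0 : 0 < mass u0 := mass_gt0 u0.
set M := \sum_u mass u.
have M_gt0 : 0 < M.
  by rewrite /M (bigD1 u0) //= ltr_pwDl // sumr_ge0 // => u _; rewrite ltW.
have H u v : 2%:R / M * (mass u * p n u v) - mass u * mass v / M ^+ 2
             <= p n u v * p n v u.
  rewrite (ptrans_flip n u v).
  rewrite -subr_ge0.
  have -> : p n u v * (mass u / mass v * p n u v)
     - (2%:R / M * (mass u * p n u v) - mass u * mass v / M ^+ 2)
     = mass u / mass v * (p n u v - mass v / M) ^+ 2.
    by field; rewrite mass_neq0 gt_eqF.
  by rewrite mulr_ge0 ?sqr_ge0 // divr_ge0 // ltW.
rewrite ptraceD.
suff <- : \sum_u \sum_v (2%:R / M * (mass u * p n u v) - mass u * mass v / M ^+ 2) = 1.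
  by apply: ler_sum => u _; apply: ler_sum => v _.
transitivity (\sum_u (2%:R / M * mass u - mass u / M)).
  apply: eq_bigr => u _; rewrite sumrB -!mulr_sumr -mulr_suml ptrans_sum mulr1.
  by congr (_ - _); rewrite -mulr_sumr -/M; field; rewrite gt_eqF.
by rewrite sumrB -mulr_sumr -mulr_suml -/M; field; rewrite gt_eqF.
Qed.

Lemma ptrace_logconvex n : t (n.+1).*2 ^+ 2 <= t n.*2 * t (n.+2).*2.
Proof.
have [E|] := altP (t n.*2 =P 0).
  (* then the state space is empty *)
  suff -> : t n.+1.*2 = 0 by rewrite E mul0r expr0n.
  apply: big1 => u _; have := ptrace_even_ge1 n u.
  by rewrite addnn E ler10.
move=> nz; have t0 : 0 < t n.*2 by rewrite lt_def nz ptrace_ge0.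
have H c : 2%:R * c * t n.+1.*2 <= c ^+ 2 * t n.*2 + t n.+2.*2.
  rewrite -[in n.*2]addnn -[in n.+2.*2]addnn.
  have -> : n.+1.*2 = (n + n.+2)%N by lia.
  rewrite !ptraceD !mulr_sumr -big_split /=; apply: ler_sum => u _.
  rewrite !mulr_sumr -big_split /=; apply: ler_sum => v _.
  exact: ptrans_amgm.
have := H (t n.+1.*2 / t n.*2).
move: (t n.+1.*2) (t n.*2) (t n.+2.*2) t0 nz => b a c a0 nz.
have -> : 2%:R * (b / a) * b = (b ^+ 2 / a) *+ 2 by field.
have -> : (b / a) ^+ 2 * a = b ^+ 2 / a by field.
by rewrite mulr2n lerD2l ler_pdivrMr // mulrC.
Qed.

Lemma ptrace_growth n (u0 : T) :
  t n.*2 ^+ n.+1 <= #|T|%:R * t (n.+1).*2 ^+ n.+1.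
Proof.
have t1 j : 1 <= t j.*2 by rewrite -addnn; apply: ptrace_even_ge1.
have tgt0 j : 0 < t j.*2 by apply: lt_le_trans (t1 j).
have H : t n.*2 ^+ n.+1 <= #|T|%:R * t (n.+1).*2 ^+ n.
  elim: n => [|n IH]; first by rewrite double0 ptrace0 expr1 expr0 mulr1.
  rewrite -(ler_pM2l (exprn_gt0 n (tgt0 n.+1))) [leRHS]mulrCA.
  apply: le_trans (_ : (t n.*2 * t n.+2.*2) ^+ n.+1 <= _).
    rewrite -exprD (_ : (n + n.+2)%N = (2 * n.+1)%N) ?exprM; last by lia.
    by rewrite lerXn2r ?nnegrE ?exprn_ge0 ?mulr_ge0 ?ptrace_ge0 ?ptrace_logconvex.
  by rewrite exprMn [leRHS]mulrA ler_wpM2r ?exprn_ge0 ?ptrace_ge0.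
apply: le_trans H _; rewrite ler_wpM2l // exprS ler_peMl // exprn_ge0 //.
exact: ptrace_ge0.
Qed.

Section Related.
Variables (R : rel T) (s : F).
Hypothesis R_spread : forall y' u, \sum_(y | R y u) P y' y <= s.

Definition related_walks j n := \sum_y \sum_u (R y u)%:R * (p j y u * p n u y).

(* Walks with [p (m-1) z y / mass y <= c * p m z y' / mass y'] are counted by
   choosing [y] last, the others by choosing the path from [y'] to [z] last. *)
Lemma related_walks_le j i c : 0 < c ->
  related_walks j.+1 (i.+1 + (j + i))
    <= s * c * t (j + i).+1.*2 + t (j + i).*2 / c.
Proof.
move=> c0; set m := (j + i).+1; have c_ge0 := ltW c0.
pose S y y' z := \sum_u (R y u)%:R * (p j y' u * p i.+1 u z).
have S0 y y' z : 0 <= S y y' z.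
  by apply: sumr_ge0 => u _; rewrite !mulr_ge0 ?ptrans_ge0.
have SE y y' z : S y y' z <= p m y' z.
  rewrite /m -addnS ptransD; apply: ler_sum => u _.
  rewrite -[leRHS]mul1r ler_wpM2r ?mulr_ge0 ?ptrans_ge0 //.
  by case: (R y u).
have -> : related_walks j.+1 (i.+1 + (j + i))
   = \sum_y \sum_y' \sum_z P y y' * p (j + i) z y * S y y' z.
  apply: eq_bigr => y _; transitivity (\sum_u \sum_y' \sum_z
      P y y' * p (j + i) z y * ((R y u)%:R * (p j y' u * p i.+1 u z))).
    apply: eq_bigr => u _; rewrite -add1n !ptransD mulr_suml mulr_sumr.
    apply: eq_bigr => y' _; rewrite ptrans1 !mulr_sumr; apply: eq_bigr => z _.
    by ring.
  rewrite exchange_big /=; apply: eq_bigr => y' _.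
  by rewrite exchange_big /=; apply: eq_bigr => z _; rewrite mulr_sumr.
apply: le_trans (_ : \sum_y \sum_y' \sum_z (c * (P y' y * p m z y' * S y y' z)
    + P y y' * p (j + i) y z * p (j + i) z y / c) <= _).
  apply: ler_sum => y _; apply: ler_sum => y' _; apply: ler_sum => z _.
  have A0 : 0 <= c * (P y' y * p m z y' * S y y' z).
    by rewrite mulr_ge0 // mulr_ge0 // mulr_ge0 ?trans_ge0 ?ptrans_ge0.
  have B0 : 0 <= P y y' * p (j + i) y z * p (j + i) z y / c.
    by rewrite divr_ge0 // mulr_ge0 ?ptrans_ge0 // mulr_ge0 ?trans_ge0 ?ptrans_ge0.
  have [le|lt] := lerP (p (j + i) z y / mass y) (c * (p m z y' / mass y')).
    apply: le_trans (_ : c * (P y' y * p m z y' * S y y' z) <= _); last by rewrite lerDl.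
    rewrite [leRHS]mulrA ler_wpM2r // [leRHS]mulrA.
    have -> : P y y' = P y' y * mass y' / mass y.
      by apply: (mulfI (mass_neq0 y)); rewrite trans_rev; field.
    have -> : P y' y * mass y' / mass y * p (j + i) z y
       = P y' y * mass y' * (p (j + i) z y / mass y) by ring.
    have -> : c * P y' y * p m z y' = P y' y * mass y' * (c * (p m z y' / mass y')).
      by field.
    by rewrite ler_wpM2l // mulr_ge0 ?trans_ge0 // ltW.
  apply: le_trans (_ : P y y' * p (j + i) y z * p (j + i) z y / c <= _); last by rewrite lerDr.
  have -> : P y y' * p (j + i) y z * p (j + i) z y / c
    = P y y' * p (j + i) z y * (p (j + i) y z / c) by ring.
  apply: ler_wpM2l; first by rewrite mulr_ge0 ?trans_ge0 ?ptrans_ge0.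
  apply: le_trans (SE _ _ _) _; rewrite ler_pdivlMr //.
  have -> : p m y' z = mass z * (p m z y' / mass y').
    by rewrite mulrA ptrans_rev; field.
  have -> : p (j + i) y z = mass z * (p (j + i) z y / mass y).
    by rewrite mulrA ptrans_rev; field.
  by rewrite -mulrA ler_wpM2l ?ltW // mulrC.
have -> : \sum_y \sum_y' \sum_z (c * (P y' y * p m z y' * S y y' z)
    + P y y' * p (j + i) y z * p (j + i) z y / c)
  = c * (\sum_y' \sum_z p m z y' * \sum_u p j y' u * p i.+1 u z * \sum_(y | R y u) P y' y)
    + t (j + i).*2 / c.
  rewrite -addnn ptraceD.
  under eq_bigr do under eq_bigr do rewrite big_split /=.
  under eq_bigr do rewrite big_split /=.
  rewrite big_split /=; congr (_ + _); last first.
    rewrite mulr_suml; apply: eq_bigr => y _.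
    rewrite exchange_big /= mulr_suml; apply: eq_bigr => z _.
    rewrite -[RHS]mul1r -(trans_sum y) mulr_suml; apply: eq_bigr => y' _.
    by rewrite !mulrA.
  rewrite exchange_big mulr_sumr /=; apply: eq_bigr => y' _.
  rewrite exchange_big mulr_sumr /=; apply: eq_bigr => z _.
  rewrite !mulr_sumr.
  under eq_bigr do rewrite !mulr_sumr.
  rewrite exchange_big /=; apply: eq_bigr => u _.
  rewrite [in RHS]big_mkcond !mulr_sumr; apply: eq_bigr => y _.
  by rewrite -mulrb -[P y' y *+ _]mulr_natl; ring.
rewrite lerD2r [s * c]mulrC -mulrA ler_wpM2l //.
rewrite -addnn ptraceD mulr_sumr; apply: ler_sum => y' _.
rewrite mulr_sumr; apply: ler_sum => z _.
rewrite [p m y' z * _]mulrC mulrCA ler_wpM2l ?ptrans_ge0 //.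
rewrite /m -addnS ptransD mulr_sumr; apply: ler_sum => u _.
by rewrite mulrC ler_wpM2r // mulr_ge0 ?ptrans_ge0.
Qed.

End Related.
End ReversibleChain.

Section ClosedWalks.

Lemma val_iter_ordS n (a : 'I_n) j : iter j (@ordS n) a = ((a + j) %% n)%N :> nat.
Proof.
elim: j => [|j IH]; first by rewrite addn0 modn_small.
by rewrite iterS /= IH -addn1 modnDml addn1 addnS.
Qed.

Lemma iter_ordS0 n (a : 'I_n.+1) : iter a (@ordS n.+1) ord0 = a.
Proof. by apply: ord_inj; rewrite val_iter_ordS /= add0n modn_small. Qed.

Lemma iter_ordS_bij n j : bijective (iter j (@ordS n)).
Proof.
elim: j => [|j IH]; first by exists id.
exact: bij_comp (@ordS_bij n) IH.
Qed.

Lemma reindex_ffun_rot (F : realFieldType) (T : finType) n j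
    (f : {ffun 'I_n -> T} -> F) :
  \sum_x f x = \sum_(x : {ffun 'I_n -> T}) f [ffun i => x (iter j (@ordS n) i)].
Proof.
have [h hK Kh] := iter_ordS_bij n j.
rewrite (reindex (fun x : {ffun 'I_n -> T} => [ffun i => x (iter j (@ordS n) i)])) //.
exists (fun x : {ffun 'I_n -> T} => [ffun i => x (h i)]) => x _;
  by apply/ffunP => i; rewrite !ffunE ?hK ?Kh.
Qed.

Lemma ordS_distance m (a b : 'I_m.*2) : a != b ->
  exists j : 'I_m, b = iter j.+1 (@ordS m.*2) a \/ a = iter j.+1 (@ordS m.*2) b.
Proof.
case: a b => a la [b lb]; rewrite -val_eqE => ab; have {}ab : a != b by [].
wlog lab : a b la lb ab / (a < b)%N.
  move=> W; have [lt|] := ltnP a b; first exact: W.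
  rewrite leq_eqVlt eq_sym (negbTE ab) /= => lt.
  have ba : b != a by rewrite eq_sym.
  by have [j [E|E]] := W b a lb la ba lt; exists j; [right|left].
have [le|gt] := leqP (b - a) m.
  have lj : ((b - a).-1 < m)%N by lia.
  exists (Ordinal lj); left; apply: ord_inj; rewrite val_iter_ordS /=.
  by rewrite prednK ?subn_gt0 // subnKC ?modn_small // ltnW.
have lj : ((a + m.*2 - b).-1 < m)%N by lia.
exists (Ordinal lj); right; apply: ord_inj; rewrite val_iter_ordS /=.
have -> : (b + (a + m.*2 - b).-1.+1 = a + m.*2)%N by lia.
by rewrite modnDr modn_small.
Qed.

Variables (F : realFieldType) (T : finType) (mu : T -> T -> F).
Hypothesis mu_ge0 : forall u v, 0 <= mu u v.
Hypothesis mu_sym : forall u v, mu u v = mu v u.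
Hypothesis mass_gt0 : forall u, 0 < mass mu u.

Local Notation p := (ptrans mu).
Local Notation P := (trans mu).
Local Notation t := (ptrace mu).

Definition walk_weight n (x : {ffun 'I_n -> T}) := \prod_(i < n) P (x i) (x (ordS i)).

Lemma walk_weight_ge0 n (x : {ffun 'I_n -> T}) : 0 <= walk_weight x.
Proof. by apply: prodr_ge0 => i _; apply: trans_ge0. Qed.

Lemma walk_weight_rot n j (x : {ffun 'I_n -> T}) :
  walk_weight [ffun i => x (iter j (@ordS n) i)] = walk_weight x.
Proof.
rewrite /walk_weight [RHS](reindex (iter j (@ordS n))) /=; last first.
  exact/onW_bij/iter_ordS_bij.
by apply: eq_bigr => i _; rewrite !ffunE -iterS -iterSr.
Qed.

Lemma sum_walk_weight n : \sum_x @walk_weight n.+1 x = t n.+1.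
Proof.
rewrite (sum_cycle (fun _ _ => P)) /ptrace.
by apply: eq_bigr => u _; rewrite ptransE.
Qed.

Lemma sum_related_walk_weight (R : rel T) n j (jn : (j < n.+1)%N) :
  \sum_(x : {ffun 'I_n.+1 -> T}) (R (x ord0) (x (Ordinal jn)))%:R * walk_weight x
  = related_walks mu R j (n.+1 - j).
Proof.
pose K y i u v := (if i == j then (R y u)%:R else 1) * P u v.
transitivity (\sum_(x : {ffun 'I_n.+1 -> T})
    \prod_(i < n.+1) K (x ord0) i (x i) (x (ordS i))).
  apply: eq_bigr => x _; rewrite big_split /=; congr (_ * _).
  rewrite (bigD1 (Ordinal jn)) //= eqxx big1 ?mulr1 // => i.
  by rewrite -val_eqE /= => /negbTE ->.
rewrite sum_cycle; apply: eq_bigr => y _.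
rewrite -{1}(subnKC (ltnW jn)) kprodD; apply: eq_bigr => u _.
rewrite [LHS]mulrC [in RHS]mulrA mulrAC; congr (_ * _).
  rewrite subSn // -add1n kprodD ptransD mulr_sumr.
  apply: eq_bigr => v _; rewrite kprod1 ptrans1 /K addn0 eqxx -[LHS]mulrA.
  congr (_ * (_ * _)); rewrite ptransE; apply: eq_kprod => i _ a b.
  by rewrite -{2}(addn0 j) eqn_add2l mul1r.
rewrite ptransE; apply: eq_kprod => i ij a b.
by rewrite /K ltn_eqF // mul1r.
Qed.

Lemma sum_related_walk_weight_rot (R : rel T) n j (a : 'I_n.+1) : (j < n.+1)%N ->
  \sum_(x : {ffun 'I_n.+1 -> T}) (R (x a) (x (iter j (@ordS _) a)))%:R * walk_weight x
  = related_walks mu R j (n.+1 - j).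
Proof.
move=> jn; rewrite -(sum_related_walk_weight R jn) [RHS](reindex_ffun_rot a).
apply: eq_bigr => x _; rewrite walk_weight_rot !ffunE iter_ordS0.
congr ((R _ (x _))%:R * _); apply: ord_inj.
by rewrite !val_iter_ordS addnC.
Qed.

Lemma exists_unrelated_closed_walk (R : rel T) (s : F) (m : nat) (u0 : T) :
  symmetric R -> (0 < m)%N -> 0 < s ->
  (forall y' u, \sum_(y | R y u) P y' y <= s) ->
  (32%:R * m%:R ^+ 4 * s) ^+ m * #|T|%:R <= 1 ->
  exists2 x : {ffun 'I_m.*2 -> T},
    (forall i, 0 < mu (x i) (x (ordS i))) &
    (forall a b, a != b -> ~~ R (x a) (x b)).
Proof.
move=> Rsym m0 s0 Rs small.
have H : exists x : {ffun 'I_m.*2 -> T}, 0 < walk_weight x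
    * (1 - \sum_a \sum_(j < m) (R (x a) (x (iter j.+1 (@ordS _) a)))%:R).
  pose f (x : {ffun 'I_m.*2 -> T}) := walk_weight x
    * (1 - \sum_a \sum_(j < m) (R (x a) (x (iter j.+1 (@ordS _) a)))%:R).
  case: (pickP (fun x => 0 < f x)) => [x fx|N]; first by exists x.
  suff : 0 < \sum_x f x.
    by rewrite ltNge sumr_le0 // => x _; rewrite leNgt N.
  rewrite /f {N f}.
  under eq_bigr do rewrite mulrBr mulr1 mulr_sumr.
  rewrite sumrB exchange_big /=.
  have -> : \sum_(a < m.*2) \sum_(x : {ffun 'I_m.*2 -> T})
       walk_weight x * (\sum_(j < m) (R (x a) (x (iter j.+1 (@ordS _) a)))%:R)
     = \sum_(a < m.*2) \sum_(j < m) related_walks mu R j.+1 (m.*2 - j.+1).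
    apply: eq_bigr => a _; under eq_bigr do rewrite mulr_sumr.
    rewrite exchange_big /=; apply: eq_bigr => j _.
    case: m m0 a j {small} => // m _ a j.
    rewrite -(sum_related_walk_weight_rot R a); last first.
      by have lj := ltn_ord j; rewrite -doubleS; lia.
    by apply: eq_bigr => x _; rewrite mulrC.
  have t1 : 1 <= t m.*2 by rewrite -addnn ptrace_even_ge1.
  have tT : \sum_x @walk_weight m.*2 x = t m.*2.
    by case: m m0 {small t1} => // m _; rewrite doubleS sum_walk_weight.
  rewrite tT subr_gt0.
  have mF : 0 < m%:R :> F by rewrite ltr0n.
  pose c : F := (8%:R * m%:R ^+ 2 * s)^-1.
  have c0 : 0 < c by rewrite invr_gt0 !mulr_gt0 ?exprn_gt0.
  have A0 : 0 <= 32%:R * m%:R ^+ 4 * s by rewrite ltW // !mulr_gt0 ?exprn_gt0.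
  have tt : 32%:R * m%:R ^+ 4 * s * t m.-1.*2 <= t m.*2.
    rewrite -(@ler_pXn2r _ m) ?nnegrE ?ptrace_ge0 ?(mulr_ge0 A0) ?ptrace_ge0 //.
    have /= := ptrace_growth mu_ge0 mu_sym mass_gt0 m.-1 u0; rewrite prednK // => G.
    rewrite exprMn; apply: le_trans (_ : (32%:R * m%:R ^+ 4 * s) ^+ m *
        (#|T|%:R * t m.*2 ^+ m) <= _).
      by rewrite ler_wpM2l // exprn_ge0.
    by rewrite mulrA ler_piMl // exprn_ge0 // ptrace_ge0.
  apply: le_lt_trans (_ : \sum_(a < m.*2) \sum_(j < m)
      (s * c * t m.*2 + t m.-1.*2 / c) < _).
    apply: ler_sum => a _; apply: ler_sum => j _.
    have /= := related_walks_le mu_ge0 mu_sym mass_gt0 Rs j (m.-1 - j) c0.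
    have lj := ltn_ord j.
    have -> : (j + (m.-1 - j) = m.-1)%N by lia.
    have -> : ((m.-1 - j).+1 + m.-1 = m.*2 - j.+1)%N by lia.
    by rewrite prednK.
  rewrite !sumr_const !card_ord.
  move: (t m.*2) (t m.-1.*2) tt t1 => X Y tt t1.
  rewrite -mulrnA -mulr_natr natrM -muln2 natrM.
  have -> : (s * c * X + Y / c) * (m%:R * (m%:R * 2%:R))
    = X / 4%:R + 16%:R * m%:R ^+ 4 * s * Y by rewrite /c; field; rewrite !gt_eqF.
  lra.
case: H => x; have w0 := walk_weight_ge0 x.
have [->|wN0] := eqVneq (walk_weight x) 0; first by rewrite mul0r ltxx.
have w_gt0 : 0 < walk_weight x by rewrite lt_def wN0.
rewrite pmulr_rgt0 // subr_gt0 => lt1; exists x => [i|a b ab].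
  rewrite lt_def mu_ge0 andbT; apply: contraNneq wN0 => mu0.
  by rewrite /walk_weight (bigD1 i) //= /trans mu0 !mul0r.
have noR a' (j : 'I_m) : ~~ R (x a') (x (iter j.+1 (@ordS _) a')).
  apply/negP => Rx; move: lt1; rewrite ltNge => /negP; apply.
  rewrite (bigD1 a') //= (bigD1 j) //= Rx -addrA lerDl addr_ge0 //.
    by apply: sumr_ge0 => i _; rewrite ler0n.
  by apply: sumr_ge0 => i _; apply: sumr_ge0 => i' _; rewrite ler0n.
have [j [->|->]] := ordS_distance ab; first exact: noR.
by rewrite Rsym; apply: noR.
Qed.

End ClosedWalks.

(** * Random-walk weights of even cycles *)

Section CycleWeights.
Variables (F : realFieldType) (V : finType) (e : rel V) (d : nat).
Hypothesis e_sym : symmetric e.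
Hypothesis d_gt0 : (0 < d)%N.
Hypothesis deg_ge : forall u, (d <= #|[set v | e u v]|)%N.

Definition emu (u v : V) : F := (e u v)%:R.

Lemma emu_ge0 u v : 0 <= emu u v. Proof. exact: ler0n. Qed.

Lemma emu_sym u v : emu u v = emu v u. Proof. by rewrite /emu e_sym. Qed.

Lemma emu_mass u : d%:R <= mass emu u.
Proof.
rewrite (le_trans (_ : _ <= #|[set v | e u v]|%:R)) ?ler_nat //.
rewrite -sum1_card natr_sum big_mkcond; apply: ler_sum => v _.
by rewrite inE /emu; case: (e u v).
Qed.

Let dF_gt0 : 0 < d%:R :> F. Proof. by rewrite ltr0n. Qed.

Lemma emu_mass_gt0 u : 0 < mass emu u.
Proof. exact: lt_le_trans (emu_mass u). Qed.

Local Notation P := (trans emu).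
Local Notation p := (ptrans emu).

Lemma P_ge0 u v : 0 <= P u v.
Proof. by apply: trans_ge0; [exact: emu_ge0|exact: emu_mass_gt0]. Qed.

Lemma p_ge0 n u v : 0 <= p n u v.
Proof. by apply: ptrans_ge0; [exact: emu_ge0|exact: emu_mass_gt0]. Qed.

Lemma P_le u v : P u v <= d%:R^-1.
Proof.
apply: le_trans (_ : (mass emu u)^-1 <= _).
  rewrite -[leRHS]mul1r ler_wpM2r ?invr_ge0 ?(ltW (emu_mass_gt0 u)) //.
  by rewrite /emu; case: (e u v).
by rewrite lef_pV2 ?posrE ?emu_mass_gt0 ?emu_mass.
Qed.

Lemma P_neq0 u v : P u v != 0 -> e u v.
Proof. by rewrite /trans /emu; case: (e u v) => //; rewrite mul0r eqxx. Qed.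

Variable l : nat.
Local Notation tup := {ffun 'I_l.+1 -> V}.

Definition link (x : tup) (j : 'I_l.+1) (v : V) := P (x j) v * P v (x (ordS j)).

(* The weight of the closed walk [x_0 y_0 x_1 y_1 ...] is the product of its
   transition probabilities: with this weight, rather than the counting measure,
   the total is at least 1 and no regularity of the graph beyond a minimum
   degree is needed. *)
Definition cycle_weight (x y : tup) := \prod_j link x j (y j).

Definition broken_weight (i : 'I_l.+1) (x : tup) :=
  \prod_(j | j != i) p 2 (x j) (x (ordS j)).

Local Notation w := cycle_weight.
Local Notation Q := broken_weight.

Lemma link_ge0 x j v : 0 <= link x j v.
Proof. by rewrite mulr_ge0 ?P_ge0. Qed.

Lemma link_le x j v : link x j v <= (d%:R ^+ 2)^-1.
Proof. by rewrite expr2 invfM ler_pM ?P_ge0 ?P_le. Qed.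

Lemma link_sum x j : \sum_v link x j v = p 2 (x j) (x (ordS j)).
Proof.
by rewrite (ptransD _ 1 1); apply: eq_bigr => v _; rewrite !ptrans1.
Qed.

Lemma cycle_weight_ge0 x y : 0 <= w x y.
Proof. by apply: prodr_ge0 => j _; apply: link_ge0. Qed.

Lemma broken_weight_ge0 i x : 0 <= Q i x.
Proof. by apply: prodr_ge0 => j _; apply: p_ge0. Qed.

Lemma cycle_weight_neq0 x y : w x y != 0 ->
  forall j, e (x j) (y j) && e (y j) (x (ordS j)).
Proof.
move=> /prodf_neq0 H j; have := H j isT.
by rewrite mulf_eq0 negb_or => /andP[/P_neq0 -> /P_neq0 ->].
Qed.

Lemma kprod_ptrans2 n u v : kprod (fun=> p 2) n u v = p n.*2 u v.
Proof.
elim: n v => [|n IH] v; first by rewrite ptrans0.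
by rewrite (_ : n.+1.*2 = (n.*2 + 2)%N) ?ptransD; [apply: eq_bigr => a _; rewrite -IH|lia].
Qed.

Lemma sum_cycle_weight (u0 : V) : 1 <= \sum_x \sum_y w x y.
Proof.
have -> : \sum_x \sum_y w x y = ptrace emu l.+1.*2.
  under eq_bigr do rewrite /w -bigA_distr_bigA.
  transitivity (\sum_(x : tup) \prod_(j < l.+1) p 2 (x j) (x (ordS j))).
    by apply: eq_bigr => x _; apply: eq_bigr => j _; rewrite link_sum.
  rewrite (sum_cycle (fun _ _ => p 2)).
  by apply: eq_bigr => u _; rewrite kprod_ptrans2.
rewrite -addnn.
exact: (ptrace_even_ge1 emu_sym emu_mass_gt0 _ u0).
Qed.

Lemma sum_broken_weight i : \sum_x Q i x = #|V|%:R.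
Proof.
have rot r (x : tup) : Q ord_max [ffun j => x (iter r (@ordS _) j)] = Q (iter r (@ordS _) ord_max) x.
  rewrite /Q [RHS](reindex (iter r (@ordS l.+1))) /=; last first.
    exact/onW_bij/iter_ordS_bij.
  apply: eq_big => j; last by rewrite !ffunE -iterS -iterSr.
  by rewrite (inj_eq (bij_inj (iter_ordS_bij _ _))).
have -> : i = iter i.+1 (@ordS _) ord_max.
  by apply: ord_inj; rewrite val_iter_ordS /= addnS -addSn modnDl modn_small.
transitivity (\sum_x Q ord_max x).
  rewrite [RHS](reindex_ffun_rot i.+1); apply: eq_bigr => x _.
  by rewrite rot.
pose K i u v := if i == l then 1 else p 2 u v.
transitivity (\sum_(x : tup) \prod_(j < l.+1) K j (x j) (x (ordS j))).
  apply: eq_bigr => x _; rewrite /Q big_mkcond; apply: eq_bigr => j _.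
  by rewrite /K -val_eqE /=; case: (_ == _).
rewrite (sum_cycle (fun _ => K)) -sum1_card natr_sum; apply: eq_bigr => u _ /=.
rewrite -(ptrans_sum emu_mass_gt0 l.*2 u); apply: eq_bigr => v _.
rewrite {2}/K eqxx mulr1 -kprod_ptrans2; apply: eq_kprod => j jl a b.
by rewrite /K ltn_eqF.
Qed.

Lemma sum_cycle_weight_fixed i v x : \sum_(y : tup | y i == v) w x y = link x i v * Q i x.
Proof.
transitivity (\sum_(y : tup) \prod_j
   (if j == i then (y j == v)%:R * link x j (y j) else link x j (y j))).
  rewrite big_mkcond /=; apply: eq_bigr => y _.
  rewrite (bigD1 i) //= eqxx /w (bigD1 i) //=.
  case: eqP => _; rewrite ?mul1r ?mul0r //; congr (_ * _).
  by apply: eq_bigr => j /negbTE ->.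
rewrite -(bigA_distr_bigA (fun j u =>
   if j == i then (u == v)%:R * link x j u else link x j u)) /=.
rewrite (bigD1 i) //= eqxx; congr (_ * _).
  by rewrite -(sum_delta v (link x i)); apply: eq_bigr => u _; rewrite eq_sym.
by apply: eq_bigr => j /negbTE ->; rewrite link_sum.
Qed.

Lemma sum_cycle_weight_coincide i j x : i != j ->
  \sum_(y : tup | y i == y j) w x y <= Q i x / d%:R ^+ 2.
Proof.
move=> ij; have ji : j != i by rewrite eq_sym.
have -> : \sum_(y : tup | y i == y j) w x y = \sum_v \sum_(y : tup) \prod_t
   (if (t == i) || (t == j) then (y t == v)%:R * link x t (y t) else link x t (y t)).
  rewrite exchange_big /= big_mkcond /=; apply: eq_bigr => y _.
  rewrite (bigD1 (y i)) //= [X in _ + X]big1 ?addr0; last first.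
    by move=> v; rewrite eq_sym => /negbTE yv; rewrite (bigD1 i) //= eqxx yv !mul0r.
  rewrite (bigD1 i) //= (bigD1 j) //= !eqxx orbT /w mul1r.
  rewrite (bigD1 i) //= (bigD1 j) //= (eq_sym (y j)).
  case: eqP => _; rewrite ?(mul1r, mul0r, mulr0) //; do 2!congr (_ * _).
  by apply: eq_bigr => t /andP[/negbTE -> /negbTE ->].
pose S := \prod_(t | (t != i) && (t != j)) p 2 (x t) (x (ordS t)).
have S0 : 0 <= S by apply: prodr_ge0 => t _; apply: p_ge0.
have -> : Q i x / d%:R ^+ 2 = \sum_v (d%:R ^+ 2)^-1 * (link x j v * S).
  rewrite -mulr_sumr -mulr_suml link_sum mulrC; congr (_ * _).
  by rewrite /Q (bigD1 j).
apply: ler_sum => v _.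
rewrite -(bigA_distr_bigA (fun t u =>
   if (t == i) || (t == j) then (u == v)%:R * link x t u else link x t u)) /=.
have E t : \sum_u (u == v)%:R * link x t u = link x t v.
  by rewrite -(sum_delta v (link x t)); apply: eq_bigr => u _; rewrite eq_sym.
rewrite (bigD1 i) //= (bigD1 j) //= !eqxx orbT !E.
rewrite (eq_bigr (fun t => p 2 (x t) (x (ordS t)))) -/S; last first.
  by move=> t /andP[/negbTE -> /negbTE ->]; rewrite link_sum.
by rewrite ler_wpM2r ?link_le // mulr_ge0 ?link_ge0.
Qed.

Definition tuple_cost x := \sum_i Q i x / d%:R ^+ 2.

Lemma tuple_cost_ge0 x : 0 <= tuple_cost x.
Proof. by apply: sumr_ge0 => i _; rewrite divr_ge0 ?broken_weight_ge0 ?exprn_ge0. Qed.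

Lemma sum_tuple_cost : \sum_x tuple_cost x = l.+1%:R * #|V|%:R / d%:R ^+ 2.
Proof.
rewrite exchange_big /= (eq_bigr (fun=> #|V|%:R / d%:R ^+ 2)).
  by rewrite sumr_const card_ord -[LHS]mulr_natl mulrA.
by move=> i _; rewrite -mulr_suml sum_broken_weight.
Qed.

Lemma broken_weight_le_cost i x : Q i x / d%:R ^+ 2 <= tuple_cost x.
Proof.
rewrite /tuple_cost (bigD1 i) //= lerDl; apply: sumr_ge0 => j _.
by rewrite divr_ge0 ?broken_weight_ge0 ?exprn_ge0.
Qed.

Lemma sum_cycle_weight_fixedl i v x : \sum_(y : tup | y i == v) w x y <= tuple_cost x.
Proof.
apply: le_trans (broken_weight_le_cost i x).
by rewrite sum_cycle_weight_fixed mulrC ler_wpM2l ?broken_weight_ge0 ?link_le.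
Qed.

Lemma cycle_weight_dual x y : w x y = w y [ffun j => x (ordS j)].
Proof.
rewrite /w /link [LHS]big_split [RHS]big_split /= [LHS]mulrC; congr (_ * _).
  by apply: eq_bigr => j _; rewrite ffunE.
rewrite (reindex (@ordS l.+1)) /=; last exact/onW_bij/ordS_bij.
by apply: eq_bigr => j _; rewrite ffunE.
Qed.

Lemma reindex_rot1 (f : tup -> F) : \sum_(x : tup) f [ffun j => x (ordS j)] = \sum_x f x.
Proof. by rewrite [RHS](reindex_ffun_rot 1). Qed.

Lemma sum_cycle_weight_fixedr i v y : \sum_(x : tup | x i == v) w x y <= tuple_cost y.
Proof.
apply: le_trans (sum_cycle_weight_fixedl (ord_pred i) v y).
rewrite big_mkcond [leRHS]big_mkcond -[leRHS]reindex_rot1 /=.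
by apply: ler_sum => x _; rewrite ffunE ord_predK -cycle_weight_dual.
Qed.

Lemma sum_noninjective_weightl x :
  \sum_(y : tup | ~~ injectiveb y) w x y <= l.+1%:R * tuple_cost x.
Proof.
apply: le_trans (_ : \sum_(i < l.+1) \sum_(j < l.+1 | i != j)
    \sum_(y : tup | y i == y j) w x y <= _).
  have -> : \sum_(i < l.+1) \sum_(j < l.+1 | i != j) \sum_(y : tup | y i == y j) w x y
    = \sum_(y : tup) \sum_(i < l.+1) \sum_(j < l.+1 | (i != j) && (y i == y j)) w x y.
    rewrite exchange_big /=; apply: eq_bigr => i _.
    under [LHS]eq_bigr do rewrite big_mkcond.
    rewrite exchange_big /=; apply: eq_bigr => y _.
    by rewrite -big_mkcondr.
  rewrite [leLHS]big_mkcond; apply: ler_sum => y _.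
  have G0 : 0 <= \sum_(i < l.+1) \sum_(j < l.+1 | (i != j) && (y i == y j)) w x y.
    by do 2!apply: sumr_ge0 => ? _; apply: cycle_weight_ge0.
  case: ifP => // /injectivePn [i [j ij yij]].
  rewrite (bigD1 i) //= (bigD1 j) /= ?ij ?yij //= -addrA lerDl addr_ge0 //.
    by apply: sumr_ge0 => ? _; apply: cycle_weight_ge0.
  by do 2!apply: sumr_ge0 => ? _; apply: cycle_weight_ge0.
rewrite mulrC mulr_natr -sumrMnl.
apply: ler_sum => i _.
apply: le_trans (_ : \sum_(j < l.+1 | i != j) Q i x / d%:R ^+ 2 <= _).
  by apply: ler_sum => j ij; apply: sum_cycle_weight_coincide.
rewrite sumr_const; apply: ler_wpMn2l.
  by rewrite divr_ge0 ?broken_weight_ge0 ?exprn_ge0.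
by rewrite (leq_trans (max_card _)) ?card_ord.
Qed.

Lemma sum_noninjective_weightr y :
  \sum_(x : tup | ~~ injectiveb x) w x y <= l.+1%:R * tuple_cost y.
Proof.
apply: le_trans (sum_noninjective_weightl y).
rewrite big_mkcond [leRHS]big_mkcond -[leRHS]reindex_rot1 /=.
apply: ler_sum => x _; rewrite -cycle_weight_dual.
suff -> : injectiveb [ffun j => x (ordS j)] = injectiveb x by [].
apply/injectiveP/injectiveP => xI i j.
  by move=> E; apply: (can_inj (@ord_predK _)); apply: xI; rewrite !ffunE !ord_predK.
by rewrite !ffunE => /xI /(bij_inj (@ordS_bij _)).
Qed.

Definition simple_weight (x y : tup) := w x y *+ (injectiveb x && injectiveb y).

Lemma simple_weight_ge0 x y : 0 <= simple_weight x y.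
Proof. by rewrite mulrn_wge0 ?cycle_weight_ge0. Qed.

Lemma simple_weight_le x y : simple_weight x y <= w x y.
Proof. by rewrite /simple_weight; case: (_ && _); rewrite ?mulr0n ?cycle_weight_ge0. Qed.

Lemma sum_simple_weight (u0 : V) :
  1 - 2%:R * (l.+1%:R ^+ 2 * #|V|%:R / d%:R ^+ 2) <= \sum_x \sum_y simple_weight x y.
Proof.
rewrite lerBlDr; apply: le_trans (sum_cycle_weight u0) _.
apply: le_trans (_ : \sum_x \sum_y simple_weight x y +
    (\sum_x \sum_(y : tup | ~~ injectiveb y) w x y
   + \sum_y \sum_(x : tup | ~~ injectiveb x) w x y) <= _).
  rewrite [X in _ + (_ + X)](exchange_big_dep xpredT) //= -!big_split /=.
  apply: ler_sum => x _.
  rewrite [X in _ + (X + _)]big_mkcond [X in _ + (_ + X)]big_mkcond -!big_split /=.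
  apply: ler_sum => y _; rewrite /simple_weight.
  have w0 := cycle_weight_ge0 x y.
  by case: (injectiveb x); case: (injectiveb y); rewrite /= ?mulr0n ?mulr1n; lra.
rewrite lerD2l mulr2n mulrDl !mul1r.
have E : l.+1%:R ^+ 2 * #|V|%:R / d%:R ^+ 2 = \sum_x l.+1%:R * tuple_cost x :> F.
  by rewrite -mulr_sumr sum_tuple_cost expr2 !mulrA.
rewrite E; apply: lerD; apply: ler_sum => x _.
  exact: sum_noninjective_weightl.
exact: sum_noninjective_weightr.
Qed.

End CycleWeights.

(** * Closed walks of pairwise disjoint tuples *)

Section DenseCore.
Variables (F : realFieldType) (X Y : finType) (f : X -> Y -> F) (c : X -> F) (c' : Y -> F).

(* Take [A] and [B] maximizing the weight inside [A * B] minus the total cost. *)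
Lemma dense_core :
  (forall x, 0 <= c x) -> (forall y, 0 <= c' y) ->
  \sum_x c x + \sum_y c' y < \sum_x \sum_y f x y ->
  exists (A : {set X}) (B : {set Y}), [/\ exists x, x \in A,
    forall x, x \in A -> c x <= \sum_(y in B) f x y &
    forall y, y \in B -> c' y <= \sum_(x in A) f x y].
Proof.
move=> c0 c'0 lt.
pose phi (p : {set X} * {set Y}) := \sum_(x in p.1) \sum_(y in p.2) f x y
  - \sum_(x in p.1) c x - \sum_(y in p.2) c' y.
have [[A B] /= _ AB] := @Order.TotalTheory.arg_maxP _ _ _ (setT, setT) xpredT phi isT.
exists A, B; split.
- have := AB (setT, setT) isT; rewrite /phi /=.
  under eq_bigl do rewrite in_setT.
  under eq_bigr do under eq_bigl do rewrite in_setT.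
  under [X in _ - X - _ <= _]eq_bigl do rewrite in_setT.
  under [X in _ - _ - X <= _]eq_bigl do rewrite in_setT.
  have [->|/set0Pn[x xA] _] := eqVneq A set0; last by exists x.
  rewrite !big_set0; have : 0 <= \sum_(y in B) c' y by apply: sumr_ge0.
  by move: lt; lra.
- move=> x xA; have := AB (A :\ x, B) isT; rewrite /phi /=.
  by rewrite (big_setD1 x xA) (big_setD1 (F := c) x xA) /=; lra.
move=> y yB; have := AB (A, B :\ y) isT; rewrite /phi /=.
rewrite (big_setD1 (F := c') y yB) /=.
under [X in _ <= X - _ - _]eq_bigr do rewrite (big_setD1 y yB).
by rewrite big_split /=; lra.
Qed.

End DenseCore.

Section ClosedTupleWalk.
Variables (F : realFieldType) (V : finType) (e : rel V) (d l m : nat).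
Hypothesis e_sym : symmetric e.
Hypothesis d_gt0 : (0 < d)%N.
Hypothesis m_gt0 : (0 < m)%N.
Hypothesis deg_ge : forall u, (d <= #|[set v | e u v]|)%N.
Local Notation tup := {ffun 'I_l.+1 -> V}.
Hypothesis d_large :
  ((512 * m ^ 4 * l.+1 ^ 3 * #|V|) ^ m * #|V| ^ l.+1 <= (d ^ 2) ^ m)%N.

Local Notation sw := (@simple_weight F V e l).
Local Notation cost := (@tuple_cost F V e d l).

(* The Boolean records which side of the cycle a tuple is on; consecutive tuples
   of a walk are on opposite sides. *)
Definition tmu (z z' : bool * tup) : F :=
  if z.1 == z'.1 then 0 else if z.1 then sw z'.2 z.2 else sw z.2 z'.2.

Lemma tmu_ge0 z z' : 0 <= tmu z z'.
Proof.
rewrite /tmu; case: ifP => // _.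
by case: ifP => _; apply: (simple_weight_ge0 F d_gt0 deg_ge).
Qed.

Lemma tmu_sym z z' : tmu z z' = tmu z' z.
Proof. by case: z z' => [[] x] [[] y]. Qed.

Lemma sum_tmu (Q : pred (bool * tup)) z :
  \sum_(z' | Q z') tmu z z' =
  \sum_(y | Q (~~ z.1, y)) if z.1 then sw y z.2 else sw z.2 y.
Proof.
transitivity (\sum_s \sum_(y | Q (s, y)) tmu z (s, y)).
  by rewrite pair_big_dep; apply: eq_big => [[s y]|[s y] _].
rewrite big_bool; case: z => -[] x /=; rewrite /tmu /=; first by rewrite big1 ?add0r.
by rewrite [X in _ + X]big1 ?addr0.
Qed.

Definition meets (z z' : bool * tup) := [exists i, exists j, z.2 i == z'.2 j].

Lemma meets_sym : symmetric meets.
Proof.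
by move=> z z'; apply/existsP/existsP => -[i /existsP[j E]];
  exists j; apply/existsP; exists i; rewrite eq_sym.
Qed.

Lemma sum_tmu_meets z u :
  \sum_(z' | meets z' u) tmu z z' <= l.+1%:R ^+ 2 * cost z.2.
Proof.
have C i j : \sum_(z' : bool * tup | z'.2 i == u.2 j) tmu z z' <= cost z.2.
  rewrite sum_tmu; case: z => -[] x /=.
    apply: le_trans (sum_cycle_weight_fixedr F d_gt0 deg_ge i (u.2 j) x).
    by apply: ler_sum => y _; apply: (simple_weight_le F d_gt0 deg_ge).
  apply: le_trans (sum_cycle_weight_fixedl F d_gt0 deg_ge i (u.2 j) x).
  by apply: ler_sum => y _; apply: (simple_weight_le F d_gt0 deg_ge).
apply: le_trans (_ : \sum_i \sum_j \sum_(z' : bool * tup | z'.2 i == u.2 j) tmu z z' <= _).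
  have -> : \sum_i \sum_j \sum_(z' : bool * tup | z'.2 i == u.2 j) tmu z z'
     = \sum_(z' : bool * tup) \sum_i \sum_(j | z'.2 i == u.2 j) tmu z z'.
    rewrite [RHS]exchange_big /=; apply: eq_bigr => i _.
    under [LHS]eq_bigr do rewrite big_mkcond.
    by rewrite exchange_big /=; apply: eq_bigr => y _; rewrite -big_mkcond.
  rewrite [leLHS]big_mkcond; apply: ler_sum => y _.
  case: ifP => [/existsP[i /existsP[j E]]|_]; last first.
    by do 2!apply: sumr_ge0 => ? _; apply: tmu_ge0.
  rewrite (bigD1 i) //= (bigD1 j) //= -addrA lerDl addr_ge0 //.
    by apply: sumr_ge0 => ? _; apply: tmu_ge0.
  by do 2!apply: sumr_ge0 => ? _; apply: tmu_ge0.
apply: le_trans (_ : \sum_(i < l.+1) \sum_(j < l.+1) cost z.2 <= _).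
  by apply: ler_sum => i _; apply: ler_sum => j _.
by rewrite !sumr_const card_ord -mulrnA -[leLHS]mulr_natl natrM expr2.
Qed.

Definition linked (x y : tup) :=
  [&& injectiveb x, injectiveb y & [forall j, e (x j) (y j) && e (y j) (x (ordS j))]].

Lemma simple_weight_gt0 x y : 0 < sw x y -> linked x y.
Proof.
rewrite /simple_weight /linked.
case: (injectiveb x); case: (injectiveb y); rewrite /= ?mulr0n ?ltxx //.
rewrite mulr1n => w0; apply/forallP => j.
by apply: (@cycle_weight_neq0 F _ _ _ _ _ _ j); rewrite gt_eqF.
Qed.

Lemma closed_tuple_walk : (0 < #|V|)%N ->
  exists2 x : {ffun 'I_m.*2 -> bool * tup},
    (forall i, (x i).1 != (x (ordS i)).1 /\
       if (x i).1 then linked (x (ordS i)).2 (x i).2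
       else linked (x i).2 (x (ordS i)).2) &
    (forall i j, i != j -> ~~ meets (x i) (x j)).
Proof.
move=> V_gt0; have [u0 _] := card_gt0P V_gt0.
have [L LE] : exists L : F, L = l.+1%:R by exists l.+1%:R.
have [M ME] : exists M : F, M = m%:R by exists m%:R.
have [N NE] : exists N : F, N = #|V|%:R by exists #|V|%:R.
have [D DE] : exists D : F, D = d%:R ^+ 2 by exists (d%:R ^+ 2).
have L1 : 1 <= L by rewrite LE ler1n.
have M1 : 1 <= M by rewrite ME ler1n.
have N1 : 1 <= N by rewrite NE ler1n.
have D0 : 0 < D by rewrite DE exprn_gt0 // ltr0n.
have L0 : 0 < L by apply: lt_le_trans L1.
have M0 : 0 < M by apply: lt_le_trans M1.
have N0 : 0 < N by apply: lt_le_trans N1.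
have [[[L_ge0 M_ge0] N_ge0] D_ge0] := (ltW L0, ltW M0, ltW N0, ltW D0).
have Nl0 : 0 < N ^+ l.+1 := exprn_gt0 l.+1 N0.
have big1 : (512%:R * M ^+ 4 * L ^+ 3 * N / D) ^+ m * N ^+ l.+1 <= 1.
  have <- : (512 * m ^ 4 * l.+1 ^ 3 * #|V|)%:R = 512%:R * M ^+ 4 * L ^+ 3 * N.
    by rewrite 3!natrM 2!natrX LE ME NE.
  rewrite expr_div_n mulrAC ler_pdivrMr ?(exprn_gt0 m D0) // mul1r.
  by rewrite NE DE -!natrX -natrM ler_nat.
have D_large : 512%:R * M ^+ 4 * L ^+ 3 * N <= D.
  rewrite -[leRHS]mul1r -ler_pdivrMr //.
  have y0 : 0 <= 512%:R * M ^+ 4 * L ^+ 3 * N / D.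
    by rewrite divr_ge0 // !mulr_ge0 ?exprn_ge0.
  rewrite -(@expr_le1 _ m) //; apply: le_trans big1.
  by rewrite ler_peMr ?exprn_ge0 // exprn_ege1.
pose D' := D / (8%:R * L * N).
pose eps := (8%:R * N ^+ l.+1)^-1.
have D'0 : 0 < D' by apply: divr_gt0 => //; do 2!apply: mulr_gt0 => //.
have eps0 : 0 < eps by rewrite invr_gt0 mulr_gt0.
pose c x := D' * cost x + eps.
have cost0 x : 0 <= cost x := tuple_cost_ge0 F d_gt0 deg_ge x.
have c0 x : 0 < c x by rewrite ltr_wpDl // mulr_ge0 // ltW.
have sum_c : \sum_x c x = 4%:R^-1.
  rewrite big_split /= -mulr_sumr (sum_tuple_cost F d_gt0 deg_ge).
  rewrite sumr_const card_ffun card_ord -[eps *+ _]mulr_natl natrX -NE -LE -DE /D' /eps.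
  by field; rewrite !gt_eqF.
have LN_small : L ^+ 2 * N / D <= 512%:R^-1.
  rewrite ler_pdivrMr //; suff : 512%:R * (L ^+ 2 * N) <= D by lra.
  apply: le_trans D_large.
  have -> : 512%:R * M ^+ 4 * L ^+ 3 * N = 512%:R * (M ^+ 4 * L * (L ^+ 2 * N)) by ring.
  rewrite ler_wpM2l // ler_peMl ?mulr_ge0 ?exprn_ge0 //.
  by rewrite mulr_ege1 // exprn_ege1.
have [A [B [[x0 x0A] cA cB]]] : exists (A B : {set tup}), [/\ exists x, x \in A,
    forall x, x \in A -> c x <= \sum_(y in B) sw x y &
    forall y, y \in B -> c y <= \sum_(x in A) sw x y].
  apply: dense_core => [x|y|]; try exact: ltW.
  apply: lt_le_trans (sum_simple_weight F e_sym d_gt0 deg_ge l u0).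
  by rewrite sum_c -LE -NE -DE; move: LN_small; lra.
pose live := [pred z : bool * tup | z.2 \in if z.1 then B else A].
pose Z := {z : bool * tup | z \in live}.
pose mu (z z' : Z) := tmu (val z) (val z').
have massE z : mass mu z = \sum_(z' in live) tmu (val z) z'.
  exact: esym (big_sub live (tmu (val z))).
have mass_ge z : c (val z).2 <= mass mu z.
  rewrite massE sum_tmu; case: z => -[[] x] /=; rewrite inE /= => zl.
    by apply: le_trans (cB x zl) _; rewrite lexx.
  by apply: le_trans (cA x zl) _; rewrite lexx.
have mass_gt0 z : 0 < mass mu z by apply: lt_le_trans (mass_ge z).
have card_Z : #|{: Z}|%:R <= 2%:R * N ^+ l.+1.
  rewrite NE -natrX -natrM ler_nat card_sub.
  by apply: leq_trans (max_card _) _; rewrite card_prod card_bool card_ffun card_ord.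
pose s := L ^+ 2 / D'.
have s0 : 0 < s by rewrite divr_gt0 ?exprn_gt0.
have spread (z' u : Z) : \sum_(z : Z | meets (val z) (val u)) trans mu z' z <= s.
  rewrite -mulr_suml ler_pdivrMr //.
  apply: le_trans (_ : s * c (val z').2 <= _); last by rewrite ler_pM2l.
  apply: le_trans (_ : L ^+ 2 * cost (val z').2 <= _); last first.
    rewrite /c mulrDr mulrA /s divfK ?gt_eqF // lerDl.
    exact: mulr_ge0 (ltW s0) (ltW eps0).
  rewrite LE; apply: le_trans (sum_tmu_meets (val z') (val u)).
  rewrite -(big_sub_cond live (fun z => meets z (val u)) (tmu (val z'))).
  rewrite [leRHS]big_mkcond [leLHS]big_mkcond.
  by apply: ler_sum => z _; case: (z \in live) => //=; case: ifP => // _; apply: tmu_ge0.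
have small : (32%:R * m%:R ^+ 4 * s) ^+ m * #|{: Z}|%:R <= 1.
  apply: le_trans big1; set y := _ * N / D.
  have -> : 32%:R * m%:R ^+ 4 * s = y / 2%:R.
    by rewrite -ME /s /D' /y; field; rewrite !gt_eqF.
  have y0 : 0 <= y by rewrite /y divr_ge0 // !mulr_ge0 ?exprn_ge0.
  apply: le_trans (_ : (y ^+ m / 2%:R) * (2%:R * N ^+ l.+1) <= _); last first.
    by rewrite mulrA divfK ?pnatr_eq0 ?lexx.
  apply: ler_pM => //; first by apply: exprn_ge0; apply: divr_ge0.
  rewrite expr_div_n ler_wpM2l ?exprn_ge0 //.
  by rewrite lef_pV2 ?posrE ?exprn_gt0 // -natrX ler_nat -{1}(expn1 2) leq_exp2l.
have x0live : (false, x0) \in live by [].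
pose z0 : Z := exist (fun z => z \in live) (false, x0) x0live.
have [x xmu xR] := @exists_unrelated_closed_walk _ _ mu
  (fun z z' => tmu_ge0 (val z) (val z')) (fun z z' => tmu_sym (val z) (val z'))
  mass_gt0 (fun z z' => meets (val z) (val z')) s m z0
  (fun z z' => meets_sym (val z) (val z')) m_gt0 s0 spread small.
exists [ffun i => val (x i)] => [i|i j ij]; last by rewrite !ffunE; apply: xR.
rewrite !ffunE; move: (xmu i); rewrite /mu /tmu.
case: eqP => [_|_]; first by rewrite ltxx.
by case: ifP => _ /simple_weight_gt0.
Qed.

End ClosedTupleWalk.

(** * Extremal number of the torus *)

Section MinimumDegree.
Local Open Scope nat_scope.

(* Take [S] maximizing [e(S) - d |S|]. *)
Lemma min_degree_subset (n d : nat) (E : {set {set 'I_n}}) :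
  simple_graph E -> n * d < #|E| ->
  exists2 S : {set 'I_n}, 0 < #|S| &
    forall v, v \in S -> d <= #|[set u in S | [set v; u] \in E]|.
Proof.
move=> /forallP simpleE ltE.
have cardE f : f \in E -> #|f| = 2 by move=> fE; have /implyP/(_ fE)/eqP := simpleE f.
pose inside (S : {set 'I_n}) := [set f in E | f \subset S].
pose phi (S : {set 'I_n}) := #|inside S| + d * #|~: S|.
have [S _ Smax] := @arg_maxnP _ setT xpredT phi isT.
exists S => [|v vS].
  have := Smax setT isT; rewrite /phi.
  have -> : inside setT = E by apply/setP => f; rewrite inE subsetT andbT.
  rewrite setCT cards0 muln0 addn0 card_gt0; apply: contraTneq => ->.
  rewrite setC0 cardsT card_ord -ltnNge [inside _](_ : _ = set0).
    by rewrite cards0 add0n mulnC.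
  apply/setP => f; rewrite !inE subset0; apply/andP => -[/cardE f2 /eqP f0].
  by rewrite f0 cards0 in f2.
pose star := [set f : {set 'I_n} in inside S | v \in f].
have le_star : d <= #|star|.
  have := Smax (S :\ v) isT; rewrite /phi setCD setUC cardsU1 inE vS /= => le.
  have : #|inside S| <= #|inside (S :\ v)| + #|star|.
    rewrite -(cardsID [set f : {set 'I_n} | v \in f] (inside S)) addnC.
    apply: leq_add; apply: subset_leq_card.
      apply/subsetP => f; rewrite !inE => /and3P[vf fE fS].
      by rewrite fE subsetD1 fS vf.
    by apply/subsetP => f; rewrite !inE => /andP[-> ->].
  move: le; rewrite mulnDr muln1 addnA leq_add2r => le1 le2.
  by rewrite -(leq_add2l #|inside (S :\ v)|) (leq_trans le1).
apply: leq_trans le_star _.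
apply: leq_trans (leq_imset_card (fun u => [set v; u]) _).
apply: subset_leq_card; apply/subsetP => f; rewrite !inE => /andP[/andP[fE fS] vf].
have /cards1P [u fu] : #|f :\ v| == 1.
  by have := cardsD1 v f; rewrite vf (cardE f fE) add1n => -[<-].
have Ef : f = [set v; u] by rewrite -fu setD1K.
apply/imsetP; exists u => //; rewrite inE -Ef fE andbT.
by apply: (subsetP fS); rewrite Ef !inE eqxx orbT.
Qed.

End MinimumDegree.

Section TorusCopy.
Local Open Scope nat_scope.
Variables (n m l d : nat) (E : {set {set 'I_n}}).
Hypothesis E_simple : simple_graph E.
Hypothesis m_gt0 : 0 < m.

Lemma torus_copy : n * d < #|E| ->
  (512 * m ^ 4 * l.+1 ^ 3 * n) ^ m * n ^ l.+1 <= (d ^ 2) ^ m ->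
  contains_copy (@torus_adj m.*2 l.+1) E.
Proof.
move=> ltE d_large; have [S S_gt0 degS] := min_degree_subset E_simple ltE.
pose V := {v : 'I_n | v \in S}.
pose e (u v : V) := [set val u; val v] \in E.
have e_sym : symmetric e by move=> u v; rewrite /e setUC.
have cardV : #|{: V}| = #|S| by rewrite card_sig; apply: eq_card => v; rewrite inE.
have Sn : #|S| <= n by rewrite -[leqRHS]card_ord max_card.
have n_gt0 : 0 < n by apply: leq_trans Sn.
have d_gt0 : 0 < d.
  rewrite lt0n; apply: contraTneq d_large => ->.
  by rewrite exp0n // exp0n // -ltnNge muln_gt0 !expn_gt0 !muln_gt0 ?expn_gt0 n_gt0 m_gt0.
have deg_ge (u : V) : d <= #|[set v | e u v]|.
  apply: leq_trans (degS (val u) (valP u)) _.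
  rewrite -(card_imset _ val_inj) subset_leq_card //.
  apply/subsetP => v; rewrite inE => /andP[vS uv].
  by apply/imsetP; exists (exist _ v vS : V); rewrite ?inE.
have d_largeV : (512 * m ^ 4 * l.+1 ^ 3 * #|{: V}|) ^ m * #|{: V}| ^ l.+1 <= (d ^ 2) ^ m.
  apply: leq_trans d_large; rewrite cardV.
  by apply: leq_mul; rewrite leq_exp2r // leq_mul.
have [|x xlink xmeet] :=
  @closed_tuple_walk rat _ e d l m e_sym d_gt0 m_gt0 deg_ge d_largeV.
  by rewrite cardV.
have k_gt0 : 0 < m.*2 by rewrite double_gt0.
pose o := Ordinal k_gt0.
have parity i (ik : i < m.*2) : (x (Ordinal ik)).1 = (x o).1 (+) odd i.
  elim: i ik => [|i IH] ik; first by rewrite addbF; congr (x _).1; apply: val_inj.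
  have [] := xlink (Ordinal (ltnW ik)); rewrite IH.
  have -> : ordS (Ordinal (ltnW ik)) = Ordinal ik.
    by apply: val_inj; rewrite /= modn_small.
  by rewrite oddS => + _; move: (x (Ordinal ik)).1 => c; case: (x o).1 c (odd i) => [] [] [].
(* start the walk on the side that makes [parity] the parity of the column *)
pose q (i : 'I_m.*2) := if (x o).1 then ordS i else i.
have q_inj : injective q.
  by rewrite /q; case: (x o).1 => // i j /(bij_inj (@ordS_bij _)).
have qS i : q (ordS i) = ordS (q i) by rewrite /q; case: ifP.
have q_parity i : (x (q i)).1 = odd i.
  have := parity i (ltn_ord i); rewrite (_ : Ordinal _ = i); last exact: val_inj.
  rewrite /q; case: (x o).1 => //= xi.
  by have [] := xlink i; rewrite xi; case: (x _).1; case: (odd i).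
pose f : {ffun 'I_m.*2 * 'I_l.+1 -> 'I_n} := [ffun p => val ((x (q p.1)).2 p.2)].
have tuple_inj i : injective (x (q i)).2.
  apply/injectiveP; have [_] := xlink (q i).
  by case: ifP => _ /and3P[].
have stepE p p' : torus_step p p' -> [set f p; f p'] \in E.
  case: p p' => [i a] [i' b] /andP[/eqP i'E ab].
  have -> : i' = ordS i by apply: val_inj.
  have [_] := xlink (q i); rewrite !ffunE /= qS q_parity.
  case: (odd i) ab => /= ab /and3P[_ _ /forallP link].
    case/orP: ab => /eqP ab.
      have -> : b = a by apply: val_inj.
      by have /andP[] := link a; rewrite e_sym.
    have -> : b = ordS a by apply: val_inj.
    by have /andP[] := link a.
  rewrite orbF in ab; case/orP: ab => /eqP ab.
    have -> : b = a by apply: val_inj.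
    by have /andP[] := link a.
  have -> : a = ordS b by apply: val_inj.
  by have /andP[_ +] := link b; rewrite e_sym.
apply/existsP; exists f; apply/andP; split.
  apply/injectiveP => -[i a] [j b]; rewrite !ffunE /= => /val_inj ab.
  have [ij|ij] := eqVneq i j; first by move: ab; rewrite ij => /tuple_inj ->.
  have := xmeet (q i) (q j); rewrite (inj_eq q_inj) => /(_ ij) /negP [].
  by apply/existsP; exists a; apply/existsP; exists b; rewrite ab.
apply/forallP => p; apply/forallP => p'; apply/implyP => /orP[|] /stepE //.
by rewrite setUC.
Qed.

End TorusCopy.

Definition torus_const (m l : nat) := (512 * m ^ 4 * l ^ 3)%N.

Lemma torus_const_gt0 m l : (0 < m)%N -> (0 < l)%N -> (0 < torus_const m l)%N.
Proof. by move=> m0 l0; rewrite !muln_gt0 ?expn_gt0 m0 l0. Qed.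

Lemma ex_torus_le (n m l : nat) : (0 < m)%N ->
  exists2 d : nat,
    (d ^ m.*2 < torus_const m l.+1 ^ m * n.+1 ^ (m + l.+1))%N &
    (ex (@torus_adj m.*2 l.+1) n.+1 <= n.+1 * d.+1)%N.
Proof.
move=> m_gt0; pose B := (torus_const m l.+1 ^ m * n.+1 ^ (m + l.+1))%N.
have k_gt0 : (0 < m.*2)%N by rewrite double_gt0.
have exB : exists d, (B <= d ^ m.*2)%N.
  by exists B; case: B => // b; rewrite -[leqLHS]expn1 leq_pexp2l.
have [d Bd dmin] := ex_minnP exB.
have d_gt0 : (0 < d)%N.
  rewrite lt0n; apply: contraTneq Bd => ->; rewrite exp0n // -ltnNge.
  by rewrite muln_gt0 !expn_gt0 torus_const_gt0.
exists d.-1.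
  by rewrite ltnNge; apply/negP => /dmin; rewrite leqNgt prednK ?leqnn.
rewrite prednK //; apply/bigmax_leqP => E /andP[Es]; apply: contraR.
rewrite -ltnNge => ltE; apply: torus_copy Es m_gt0 ltE _.
by rewrite -expnM mul2n expnMn -mulnA -expnD.
Qed.

From Stdlib Require Import Reals Lra.
Open Scope R_scope.

Lemma INR_expn (a b : nat) : INR (expn a b) = INR a ^ b.
Proof. by elim: b => // b IH; rewrite expnS mult_INR IH. Qed.

Theorem theorem1p5 :
  forall k l : nat, ~~ odd k -> (4 <= k)%nat -> (2 <= l)%nat ->
  exists C : R, exists N : nat, forall n : nat, (N <= n)%nat ->
    INR (ex (@torus_adj k l) n)
      <= C * Rpower (INR n) (3 / 2 + INR l / INR k)
           * (ln (INR n) / ln 2) ^ 2.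
Proof.
move=> k l k_even k_ge4 l_ge2.
have Ek : k = (k./2).*2 by rewrite -[LHS]odd_double_half (negbTE k_even).
have m_gt0 : (0 < k./2)%nat by rewrite half_gt0 (leq_trans _ k_ge4).
move: (k./2) m_gt0 Ek => m m_gt0 ->; case: l l_ge2 => // l _.
pose A := INR (torus_const m l.+1).
have A_ge1 : 1 <= A.
  apply: (le_INR 1); apply/ssrnat.leP.
  exact: torus_const_gt0.
have k_gt0 : 0 < INR m.*2 by apply: (lt_INR 0); apply/ssrnat.ltP; rewrite double_gt0.
exists (A + 1), 2%nat => -[//|n] n_ge2.
have [d d_lt ex_le] := ex_torus_le n l m_gt0.
have n_ge2R : 2 <= INR n.+1 by apply: (le_INR 2); apply/ssrnat.leP.
pose a := / 2 + INR l.+1 / INR m.*2; pose X := Rpower (INR n.+1) a.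
have l_ge0 : 0 <= INR l.+1 / INR m.*2.
  by apply: Rmult_le_pos; [exact: pos_INR|apply/Rlt_le/Rinv_0_lt_compat].
have X_ge1 : 1 <= X.
  rewrite -(Rpower_O (INR n.+1)); last Lra.lra.
  by apply: Rle_Rpower; rewrite /a; Lra.lra.
have XE : X ^ m.*2 = INR n.+1 ^ (addn m l.+1).
  rewrite -Rpower_pow; last Lra.lra.
  rewrite -Rpower_pow; last Lra.lra.
  rewrite /X Rpower_mult; congr (Rpower _ _).
  rewrite plus_INR /a Rmult_plus_distr_r /Rdiv Rmult_assoc Rinv_l; last Lra.lra.
  by rewrite -addnn plus_INR; Lra.lra.
have dX : INR d < A * X.
  apply: Rnot_le_lt => AXd.
  have := lt_INR _ _ (elimT ssrnat.ltP d_lt).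
  rewrite mult_INR !INR_expn -/A -XE.
  apply: Rle_not_lt; apply: Rle_trans (_ : (A * X) ^ m.*2 <= _); last first.
    by apply: pow_incr; split=> //; apply: Rmult_le_pos; Lra.lra.
  rewrite Rpow_mult_distr; apply: Rmult_le_compat_r; first by apply: pow_le; Lra.lra.
  by apply: Rle_pow => //; apply/ssrnat.leP; rewrite -addnn leq_addr.
have log_ge1 : 1 <= (ln (INR n.+1) / ln 2) ^ 2.
  have ln2_gt0 : 0 < ln 2 by rewrite -ln_1; apply: ln_increasing; Lra.lra.
  rewrite -(pow1 2); apply: pow_incr; split; first Lra.lra.
  apply: (Rmult_le_reg_r (ln 2)) => //.
  rewrite Rmult_1_l /Rdiv Rmult_assoc Rinv_l ?Rmult_1_r; last Lra.lra.
  case: n_ge2R => [n_gt2|<-]; last exact: Rle_refl.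
  by left; apply: ln_increasing; Lra.lra.
have -> : Rpower (INR n.+1) (3 / 2 + INR l.+1 / INR m.*2) = INR n.+1 * X.
  rewrite -{2}(Rpower_1 (INR n.+1)); last Lra.lra.
  by rewrite -Rpower_plus /a; congr (Rpower _ _); Lra.lra.
apply: Rle_trans (_ : (A + 1) * (INR n.+1 * X) <= _); last first.
  rewrite -{1}(Rmult_1_r ((A + 1) * _)); apply: Rmult_le_compat_l => //.
  by do 2!(apply: Rmult_le_pos; try Lra.lra).
apply: Rle_trans (le_INR _ _ (elimT ssrnat.leP ex_le)) _.
rewrite mult_INR (S_INR d) (Rmult_comm (A + 1)) Rmult_assoc.
by apply: Rmult_le_compat_l; Lra.lra.
Qed.
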